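(* For any DP-game $(\mathcal{D},\mathcal{A},C)$ with visible choice, there exists a Nash equilibrium, i.e. a mixed strategy profile $(\delta^*,\alpha^* )\in\mathbb{D}\mathcal{D}\times\mathbb{D}\mathcal{A}$ with $$\mathbb{V}^{\rm DP}(\delta^*,\alpha)\le\mathbb{V}^{\rm DP}(\delta^*,\alpha^* )\le\mathbb{V}^{\rm DP}(\delta,\alpha^* )\qquad\text{for all }\delta\in\mathbb{D}\mathcal{D},\ \alpha\in\mathbb{D}\mathcal{A}.$$ Moreover, an arbitrary mixed strategy $\alpha^*\in\mathbb{D}\mathcal{A}$ such that $\mathrm{supp}(\alpha^* )=\mathcal{A}$ is an optimal strategy for the attacker, and a pure strategy $d^*\in\operatorname{argmin}_{d\in\mathcal{D}}\max_{a\in\mathcal{A}}\mathbb{V}^{\rm DP}[C_{da}]$ is an optimal strategy for the defender.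
   Context: For a finite set $\mathcal{I}$, $\mathbb{D}\mathcal{I}$ is the set of probability distributions on $\mathcal{I}$, and $\mathrm{supp}(\mu)=\{i:\mu(i)>0\}$. A channel $C:\mathcal{X}\times\mathcal{Y}\to\mathbb{R}$ ($\mathcal{X},\mathcal{Y}$ finite) satisfies $0\le C(x,y)\le1$ and $\sum_yC(x,y)=1$ for every $x$. Given a symmetric binary relation $\sim$ on $\mathcal{X}$, a channel $C$ is conforming to $\sim$ if for all $x\sim x'$ and all $y$: $C(x,y)=0$ iff $C(x',y)=0$. For such a channel, its differential-privacy level is $$\mathbb{V}^{\rm DP}[C]=\max_{\substack{y,x,x':\ x\sim x',\\ C(x,y)>0}}\ln\frac{C(x,y)}{C(x',y)}$$ (with the convention that the maximum is $0$ if $\sim$ is empty). Visible choice: for a finite family $\{C_i\}_{i\in\mathcal{I}}$ of channels with input set $\mathcal{X}$ and common finite output set $\mathcal{Y}'$, and $\mu\in\mathbb{D}\mathcal{I}$, $\bigsqcup_{i\leftarrow\mu}C_i$ is the channel from $\mathcal{X}$ to the disjoint union $\{(y,i):y\in\mathcal{Y}',i\in\mathcal{I}\}$ given by $(x,(y,i))\mapsto\mu(i)C_i(x,y)$. A DP-game $(\mathcal{D},\mathcal{A},C)$ consists of nonempty finite sets $\mathcal{D}$ (defender's actions) and $\mathcal{A}$ (attacker's actions) and a family $\{C_{da}\}_{d\in\mathcal{D},a\in\mathcal{A}}$ of channels $\mathcal{X}\times\mathcal{Y}\to\mathbb{R}$ all conforming to a symmetric relation $\sim$ on $\mathcal{X}$.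 The game is zero-sum: the attacker maximizes and the defender minimizes the attacker's utility. With visible choice (of the defender's action), the attacker's utility of a mixed strategy profile $(\delta,\alpha)$ is $$\mathbb{V}^{\rm DP}(\delta,\alpha)=\mathbb{V}^{\rm DP}\Bigl[\bigsqcup_{a\leftarrow\alpha}\ \bigsqcup_{d\leftarrow\delta}C_{da}\Bigr].$$ A pure strategy is identified with the corresponding point distribution. A strategy of a player is optimal if it is that player's component of some Nash equilibrium. *)

(* Defs.v *)
From mathcomp Require Import all_boot all_order all_algebra.
From mathcomp Require Import all_classical all_reals all_analysis.

Set Implicit Arguments.
Unset Strict Implicit.
Unset Printing Implicit Defensive.

Import Order.TTheory GRing.Theory Num.Theory.

Local Open Scope ring_scope.

Record dist (R : realType) (I : finType) := Dist {
  dist_fun :> I -> R;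
  dist_ge0 : forall i, 0 <= dist_fun i;
  dist_sum1 : \sum_i dist_fun i = 1 }.

Definition supp (R : realType) (I : finType) (mu : dist R I) : {set I} :=
  [set i | 0 < mu i].

Lemma point_dist_ge0 (R : realType) (I : finType) (j i : I) :
  0 <= (i == j)%:R :> R.
Proof. exact: ler0n. Qed.

Lemma point_dist_sum1 (R : realType) (I : finType) (j : I) :
  \sum_i (i == j)%:R = 1 :> R.
Proof.
rewrite (bigD1 j) //= eqxx big1 ?addr0 // => i.
by move=> /negbTE ->.
Qed.

Definition point_dist (R : realType) (I : finType) (j : I) : dist R I :=
  Dist (@point_dist_ge0 R I j) (point_dist_sum1 R j).

Record channel (R : realType) (X Y : finType) := Channel {
  channel_fun :> X -> Y -> R;
  channel_bound : forall x y, 0 <= channel_fun x y <= 1;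
  channel_sum1 : forall x, \sum_y channel_fun x y = 1 }.

Definition conforming (R : realType) (X Y : finType) (sim : rel X)
    (C : channel R X Y) : Prop :=
  forall x x' y, sim x x' -> (C x y = 0 <-> C x' y = 0).

(* The maximum of F over the finite set P, and 0 when P is empty. The seed of
   the iterated maximum is itself one of the values of F on P, so that negative
   maxima are not truncated. *)
Definition fmax (R : realType) (T : finType) (P : pred T) (F : T -> R) : R :=
  if [pick t | P t] is Some t0 then \big[Num.max/F t0]_(t | P t) F t else 0.

(* A triple ((x, x'), y) satisfying the constraint exists if and only if sim is
   nonempty, since every row of a channel sums to 1; the value 0 given by fmax
   on the empty set is thus used exactly when sim is empty. *)
Definition dp_level (R : realType) (X Y : finType) (sim : rel X)
    (C : channel R X Y) : R :=
  fmax (fun t : X * X * Y => let: (x, x', y) := t in sim x x' && (0 < C x y))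
       (fun t : X * X * Y => let: (x, x', y) := t in ln (C x y / C x' y)).

Section VisibleChoice.
Variables (R : realType) (X Y I : finType).
Variables (mu : dist R I) (C : I -> channel R X Y).

Definition visible_fun (x : X) (z : Y * I) : R := mu z.2 * C z.2 x z.1.

Lemma visible_sum1 x : \sum_z visible_fun x z = 1.
Proof.
rewrite -(pair_big xpredT xpredT (fun y i => mu i * C i x y)) exchange_big /=.
rewrite -[RHS](dist_sum1 mu); apply: eq_bigr => i _.
by rewrite -mulr_sumr channel_sum1 mulr1.
Qed.

Lemma visible_bound x z : 0 <= visible_fun x z <= 1.
Proof.
have ge0 w : 0 <= visible_fun x w.
  by apply: mulr_ge0; [exact: dist_ge0 | case/andP: (channel_bound (C w.2) x w.1)].
by rewrite ge0 -(visible_sum1 x) (bigD1 z) //= lerDl sumr_ge0.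
Qed.

Definition visible_choice : channel R X (Y * I)%type :=
  Channel visible_bound visible_sum1.

Lemma visible_choice_conforming (sim : rel X) :
  (forall i, conforming sim (C i)) -> conforming sim visible_choice.
Proof.
move=> hC x x' [y i] /(hC i x x' y) [h h']; rewrite /= /visible_fun /=.
split=> /eqP; rewrite mulf_eq0 => /orP[/eqP ->|/eqP e]; rewrite ?mul0r //.
  by rewrite h // mulr0.
by rewrite h' // mulr0.
Qed.

End VisibleChoice.

Section DPGame.
Variables (R : realType) (X Y D A : finType) (sim : rel X).
Variable C : D -> A -> channel R X Y.

Definition utility (delta : dist R D) (alpha : dist R A) : R :=
  dp_level sim
    (visible_choice alpha (fun a => visible_choice delta (fun d => C d a))).

Definition nash (delta : dist R D) (alpha : dist R A) : Prop :=
  forall (delta' : dist R D) (alpha' : dist R A),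
    utility delta alpha' <= utility delta alpha <= utility delta' alpha.

Definition defender_optimal (delta : dist R D) : Prop :=
  exists alpha : dist R A, nash delta alpha.

Definition attacker_optimal (alpha : dist R A) : Prop :=
  exists delta : dist R D, nash delta alpha.

Definition worst_level (d : D) : R :=
  fmax xpredT (fun a => dp_level sim (C d a)).

Definition argmin_worst_level (d : D) : Prop :=
  forall d', worst_level d <= worst_level d'.

End DPGame.

(* Main.v *)
(** Visible choices leave the likelihood ratios of the component channels
    unchanged, so the utility of a mixed profile is the maximum of the levels of
    the channels [C d a] over the supports of the two strategies. Hence the
    defender's best play is one pure action minimizing the worst level, and an
    attacker with full support always realizes the worst level of every action
    in the defender's support. *)
Require Import Defs.
From mathcomp Require Import all_boot all_order all_algebra.
From mathcomp Require Import all_classical all_reals all_analysis.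

Set Implicit Arguments.
Unset Strict Implicit.
Unset Printing Implicit Defensive.

Import Order.TTheory GRing.Theory Num.Theory.

Local Open Scope ring_scope.

Section FiniteMax.
Variables (R : realType) (T : finType) (P : pred T) (F : T -> R).

Lemma fmax_ub t : P t -> F t <= fmax P F.
Proof.
rewrite /fmax => Pt; case: pickP => [t0 _|/(_ t)]; last by rewrite Pt.
exact: le_bigmax_cond.
Qed.

Lemma fmax_attained t : P t -> exists2 u, P u & fmax P F = F u.
Proof.
rewrite /fmax => Pt; case: pickP => [t0 Pt0|/(_ t)]; last by rewrite Pt.
(* Being a value of [F] on [P] holds for the seed [F t0] and survives [Num.max], which returns one
   of its arguments. *)
apply: (big_ind (fun m => exists2 u, P u & m = F u)).
- by exists t0.
- by move=> m1 m2 [u Pu ->] [w Pw ->]; rewrite maxElt; case: ifP; [exists w|exists u].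
- by move=> u Pu; exists u.
Qed.

Lemma fmax_pred0 : P =1 pred0 -> fmax P F = 0.
Proof. by rewrite /fmax => P0; case: pickP => // t; rewrite P0. Qed.

End FiniteMax.

Lemma sum1_gt0 (R : realType) (I : finType) (f : I -> R) :
  \sum_i f i = 1 -> exists i, 0 < f i.
Proof.
move=> f1; case: (pickP (fun i => 0 < f i)) => [i|f_le0]; first by exists i.
have : \sum_i f i <= 0 by apply: sumr_le0 => i _; rewrite leNgt f_le0.
by rewrite f1 ler10.
Qed.

Lemma uniform_dist (R : realType) (I : finType) :
  (0 < #|I|)%N -> exists mu : dist R I, supp mu = [set: I]%SET.
Proof.
move=> I_gt0; have u_gt0 : 0 < #|I|%:R^-1 :> R by rewrite invr_gt0 ltr0n.
have u1 : \sum_(i : I) #|I|%:R^-1 = 1 :> R.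
  by rewrite sumr_const -[LHS]mulr_natl mulfV // pnatr_eq0 -lt0n.
exists (@Dist R I (fun=> #|I|%:R^-1) (fun=> ltW u_gt0) u1).
by apply/setP => i; rewrite !inE.
Qed.

Section Level.
Variables (R : realType) (X : finType) (sim : rel X).

Lemma dp_level_ub (Y : finType) (K : channel R X Y) x x' y :
  sim x x' -> 0 < K x y -> ln (K x y / K x' y) <= dp_level sim K.
Proof.
move=> sxx' K_gt0; apply: (@fmax_ub _ _ _ _ (x, x', y)).
by rewrite sxx' K_gt0.
Qed.

(** One related pair suffices: the row of [x] sums to 1, so some output has positive probability and
    the maximum ranges over a nonempty set. *)
Lemma dp_level_attained (Y : finType) (K : channel R X Y) x x' : sim x x' ->
  exists z z' y, [/\ sim z z', 0 < K z y & dp_level sim K = ln (K z y / K z' y)].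
Proof.
move=> sxx'; have [y K_gt0] := sum1_gt0 (channel_sum1 K x).
rewrite /dp_level; set P := (P in fmax P _); set F := (F in fmax _ F).
have Pt : P (x, x', y) by rewrite /P sxx' K_gt0.
have [[[z z'] w] /andP[szz' Kw_gt0] ->] := fmax_attained F Pt.
by exists z, z', w.
Qed.

Lemma dp_level_sim0 (Y : finType) (K : channel R X Y) :
  (forall x x', sim x x' = false) -> dp_level sim K = 0.
Proof. by move=> sim0; apply: fmax_pred0 => -[[x x'] y] /=; rewrite sim0. Qed.

Lemma sim_dec : (exists x x', sim x x') \/ (forall x x', sim x x' = false).
Proof.
case: (pickP (fun p : X * X => sim p.1 p.2)) => [[x x'] sxx'|sim0].
  by left; exists x, x'.
by right=> x x'; exact: (sim0 (x, x')).
Qed.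

Variables (Y I : finType) (mu : dist R I) (C : I -> channel R X Y).

(** The weight [mu i] cancels. If [C i x' y] is 0, both sides are 0 by the convention for division
    by zero. *)
Lemma visible_ratio x x' y i : 0 < mu i ->
  visible_choice mu C x (y, i) / visible_choice mu C x' (y, i) =
  C i x y / C i x' y.
Proof. by move=> mu_gt0; rewrite /= /visible_fun /= -mulf_div divff ?mul1r ?gt_eqF. Qed.

(** A maximizing triple of [C i], with its output tagged by [i], is admissible for the visible
    choice and has the same ratio. *)
Lemma visible_level_ge i : 0 < mu i ->
  dp_level sim (C i) <= dp_level sim (visible_choice mu C).
Proof.
move=> mu_gt0; have [[x [x' sxx']]|sim0] := sim_dec; last by rewrite !dp_level_sim0.
have [z [z' [y [szz' C_gt0 ->]]]] := dp_level_attained (C i) sxx'.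
rewrite -(visible_ratio _ _ _ mu_gt0); apply: dp_level_ub => //.
exact: mulr_gt0.
Qed.

Lemma visible_level_le c : (forall i, 0 < mu i -> dp_level sim (C i) <= c) ->
  dp_level sim (visible_choice mu C) <= c.
Proof.
move=> le_c; have [[x [x' sxx']]|sim0] := sim_dec; last first.
  (* For an empty relation both levels are 0, and [0 <= c] comes from the hypothesis at any index in
     the support. *)
  have [i /le_c] := sum1_gt0 (dist_sum1 mu).
  by rewrite !dp_level_sim0.
have [z [z' [[y i] [szz' V_gt0 ->]]]] :=
  dp_level_attained (visible_choice mu C) sxx'.
(* The maximizing output carries a tag [i]; its positive probability puts [i] in the support. *)
have mu_gt0 : 0 < mu i.
  rewrite lt_def dist_ge0 andbT; apply: contraTneq V_gt0 => mu0.
  by rewrite /= /visible_fun /= mu0 mul0r ltxx.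
have C_gt0 : 0 < C i z y by rewrite -(pmulr_rgt0 _ mu_gt0).
by rewrite visible_ratio // (le_trans _ (le_c i mu_gt0)) // dp_level_ub.
Qed.

End Level.

Section Game.
Variables (R : realType) (X Y D A : finType) (sim : rel X).
Variable C : D -> A -> channel R X Y.

Lemma utility_ge (delta : dist R D) (alpha : dist R A) d a :
  0 < delta d -> 0 < alpha a -> dp_level sim (C d a) <= utility sim C delta alpha.
Proof.
move=> d_gt0 a_gt0; apply: le_trans (visible_level_ge _ _ a_gt0).
exact: (visible_level_ge _ (fun d => C d a)).
Qed.

Lemma utility_point_le d (alpha : dist R A) :
  utility sim C (point_dist R d) alpha <= worst_level sim C d.
Proof.
apply: visible_level_le => a _; apply: visible_level_le => d' /=.
have [-> _|_] := eqVneq d' d; last by rewrite ltxx.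
exact: (@fmax_ub _ _ xpredT (fun a => dp_level sim (C d a))).
Qed.

(** Full support gives positive weight to an attacker action that attains the worst level of [d]. *)
Lemma worst_level_le_utility (delta : dist R D) (alpha : dist R A) d :
  supp alpha = [set: A]%SET -> 0 < delta d ->
  worst_level sim C d <= utility sim C delta alpha.
Proof.
rewrite /worst_level => full d_gt0; have [a0 _] := sum1_gt0 (dist_sum1 alpha).
have [a _ ->] := @fmax_attained _ _ xpredT (fun a => dp_level sim (C d a)) a0 isT.
apply: utility_ge => //; have : a \in supp alpha by rewrite full inE.
by rewrite inE.
Qed.

(** Both inequalities pass through [worst_level sim C d], which is the value of the game. *)
Lemma nash_full_support d (alpha : dist R A) :
  supp alpha = [set: A]%SET -> argmin_worst_level sim C d ->
  nash sim C (point_dist R d) alpha.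
Proof.
move=> full d_min delta' alpha'; apply/andP; split.
  apply: le_trans (utility_point_le _ _) _.
  by apply: worst_level_le_utility => //=; rewrite eqxx ltr01.
(* Any single action in the support of the deviation [delta'] already costs at least the minimal
   worst level. *)
have [d' d'_gt0] := sum1_gt0 (dist_sum1 delta').
apply: le_trans (utility_point_le _ _) (le_trans (d_min d') _).
exact: worst_level_le_utility.
Qed.

Lemma argmin_worst_level_exists :
  (0 < #|D|)%N -> exists d, argmin_worst_level sim C d.
Proof.
move=> /card_gt0P[d0 _].
case: (@arg_minP _ R D d0 xpredT (worst_level sim C) isT) => d _ d_min.
by exists d => d'; exact: d_min.
Qed.

End Game.

Theorem theorem19 (R : realType) (X Y D A : finType)
    (D_nonempty : (0 < #|D|)%N) (A_nonempty : (0 < #|A|)%N)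
    (sim : rel X) (sim_sym : symmetric sim)
    (C : D -> A -> channel R X Y)
    (C_conforming : forall d a, conforming sim (C d a)) :
  [/\ exists (delta : dist R D) (alpha : dist R A), nash sim C delta alpha,
      forall alpha : dist R A, supp alpha = [set: A]%SET ->
        attacker_optimal sim C alpha
    & forall d : D, argmin_worst_level sim C d ->
        defender_optimal sim C (point_dist R d)].
Proof.
have [d d_min] := argmin_worst_level_exists sim C D_nonempty.
(* The uniform strategy is a full-support partner for every minimizing defender action. *)
have [alpha full] := uniform_dist R A_nonempty.
split.
- by exists (point_dist R d), alpha; exact: nash_full_support.
- by move=> alpha' full'; exists (point_dist R d); exact: nash_full_support.
- by move=> d' d'_min; exists alpha; exact: nash_full_support.
Qed.
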